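(* Let $K$ be a virtual knot with odd writhe polynomial $W_K(t)=\sum_i b_i t^i\in\mathbb{Z}[t,t^{-1}]$. Then $$F(K) \geq \frac{1}{2}\sum_i |b_i|,$$ where $F(K)$ is the forbidden number of $K$.
   Context: A virtual knot is an equivalence class of (oriented) virtual knot diagrams, with classical and virtual crossings, modulo the extended Reidemeister moves: the classical moves $R1,R2,R3$, the virtual moves $V1,V2,V3$ and the semivirtual move $SV$. The Gauss diagram of a diagram is an oriented circle (traditionally counter-clockwise) with one signed arrow (chord) per classical crossing; the two endpoints of the arrow are the two passages through that crossing, the arrow points from the overcrossing (tail) to the undercrossing (head), and it carries the sign $\pm1$ of the crossing. Virtual knots correspond to Gauss diagrams modulo the Gauss diagram versions of $R1,R2,R3$. The forbidden moves: $FO$ moves a strand of the diagram over a virtual crossing; on Gauss diagrams it interchanges two adjacent tails of two different arrows. $FU$ moves a strand under a virtual crossing; on Gauss diagrams it interchanges two adjacent heads of two different arrows. Signs of arrows are arbitrary and unchanged in both moves. The forbidden number $F(K)$ is the minimum number of forbidden moves needed to transform $K$ into the unknot, taken over all diagrams of $K$ and with unlimited use of extended Reidemeister moves. A classical crossing is odd if, in the Gauss diagram, the number of arrow endpoints lying between the two endpoints of its arrow is odd; otherwise it is even. Odd writhe polynomial (Cheng): let $c_1,\dots,c_n$ be the classical crossings of a diagram of $K$. The $2n$ endpoints of the arrows divide the circle of the Gauss diagram into $2n$ arcs. To each arc assign an integer: start at a point in the arc and follow the orientation of the circle once around; for each arrow one first encounters either its head or its tail; the integer assigned to the arc is the sum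 of the signs of the arrows whose heads are encountered first. For a crossing $c_i$, let $h_1,h_2$ be the labels of the two arcs incident to the head of its arrow and $t_1,t_2$ the labels of the two arcs incident to its tail, and put $N(c_i)=\max\{h_1,h_2\}-\min\{t_1,t_2\}$. Then $$W_K(t)=\sum_{c_i\ \text{odd}}\mathrm{sign}(c_i)\,t^{N(c_i)}\in\mathbb{Z}[t,t^{-1}].$$ It is known (Cheng) to be an invariant of virtual knots. *)

(* Defs.v *)
From HB Require Import structures.
From mathcomp Require Import all_boot all_order all_algebra generic_quotient.
From mathcomp Require Import finmap.
From mathcomp Require Import monalg.
From mathcomp Require Import boolp.
From Stdlib Require Import Relation_Operators ArithRing.

Set Implicit Arguments.
Unset Strict Implicit.
Unset Printing Implicit Defensive.

Import Order.TTheory GRing.Theory Num.Theory.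

Local Open Scope ring_scope.
Local Open Scope quotient_scope.

(* A Gauss diagram is encoded by the cyclic word of arrow endpoints read along
   the oriented circle from some base point.  An arrow is a name together with
   its sign ([true] for -1); an endpoint is an arrow together with a flag
   ([true] for the head, i.e. the undercrossing). *)
Definition arrow : Type := (nat * bool)%type.

Definition negative (a : arrow) : bool := a.2.
Definition sign (a : arrow) : int := if negative a then - 1 else 1.

Definition endpoint : Type := (arrow * bool)%type.

Definition Tl (a : arrow) : endpoint := (a, false).
Definition Hd (a : arrow) : endpoint := (a, true).

Definition is_gauss_code (s : seq endpoint) : bool :=
  uniq s && all (fun e : endpoint => (e.1, ~~ e.2) \in s) s.

Record gauss_diagram := GaussDiagram {
  code :> seq endpoint;
  codeP : is_gauss_code code
}.

HB.instance Definition _ := [isSub for code].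
HB.instance Definition _ := [Choice of gauss_diagram by <:].

Definition swap_if (b : bool) (x y : endpoint) : seq endpoint :=
  if b then [:: y; x] else [:: x; y].

(* The three strands of an R3 configuration.  The arrow [tm] goes from the top
   strand to the middle one, [tb] from the top to the bottom, [mb] from the
   middle to the bottom.  For three directed lines in general position in the
   plane, the signs of the crossings together with the side of the third line
   on which the crossing [tm] lies (the bit [d]) determine the orders of the
   two crossings met along each line, as below; the signs and [d] can be
   prescribed arbitrarily.  R3 changes [d] only. *)
Definition r3_top (d : bool) (tm tb mb : arrow) : seq endpoint :=
  swap_if (d (+) negative tb) (Tl tm) (Tl tb).
Definition r3_mid (d : bool) (tm tb mb : arrow) : seq endpoint :=
  swap_if (d (+) negative mb) (Hd tm) (Tl mb).
Definition r3_bot (d : bool) (tm tb mb : arrow) : seq endpoint :=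
  swap_if (d (+) negative tm (+) negative tb (+) negative mb) (Hd tb) (Hd mb).

(* [gm_rotate] and [gm_rename] identify the codes of one Gauss diagram; thanks
   to [gm_rotate] the other moves may be stated with a convenient base point.
   The relation is only used between codes satisfying [is_gauss_code], so the
   arrows displayed in each move are distinct from one another and from those
   of the remaining words. *)
Inductive gauss_move : seq endpoint -> seq endpoint -> Prop :=
| gm_rotate u v : gauss_move (u ++ v) (v ++ u)
| gm_rename (f : arrow -> arrow) u :
    injective f -> (forall a, sign (f a) = sign a) ->
    gauss_move u [seq (f e.1, e.2) | e <- u]
| gm_R1_tail_first a u : gauss_move [:: Tl a, Hd a & u] u
| gm_R1_head_first a u : gauss_move [:: Hd a, Tl a & u] u
| gm_R2_parallel a b u v : sign b = - sign a ->
    gauss_move ([:: Tl a; Tl b] ++ u ++ [:: Hd a; Hd b] ++ v) (u ++ v)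
| gm_R2_antiparallel a b u v : sign b = - sign a ->
    gauss_move ([:: Tl a; Tl b] ++ u ++ [:: Hd b; Hd a] ++ v) (u ++ v)
| gm_R3_tmb d tm tb mb u v w :
    gauss_move
      (r3_top d tm tb mb ++ u ++ r3_mid d tm tb mb ++ v ++
         r3_bot d tm tb mb ++ w)
      (r3_top (~~ d) tm tb mb ++ u ++ r3_mid (~~ d) tm tb mb ++ v ++
         r3_bot (~~ d) tm tb mb ++ w)
| gm_R3_tbm d tm tb mb u v w :
    gauss_move
      (r3_top d tm tb mb ++ u ++ r3_bot d tm tb mb ++ v ++
         r3_mid d tm tb mb ++ w)
      (r3_top (~~ d) tm tb mb ++ u ++ r3_bot (~~ d) tm tb mb ++ v ++
         r3_mid (~~ d) tm tb mb ++ w).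

Definition gauss_equiv : gauss_diagram -> gauss_diagram -> Prop :=
  clos_refl_sym_trans gauss_diagram (fun D E => gauss_move D E).

Definition gauss_eqvb (D E : gauss_diagram) : bool := `[< gauss_equiv D E >].

Lemma gauss_eqvb_refl : reflexive gauss_eqvb.
Proof. by move=> D; apply/asboolP; apply: rst_refl. Qed.

Lemma gauss_eqvb_sym : symmetric gauss_eqvb.
Proof. by move=> D E; apply/asboolP/asboolP => h; apply: rst_sym. Qed.

Lemma gauss_eqvb_trans : transitive gauss_eqvb.
Proof.
move=> E D G /asboolP h /asboolP k; apply/asboolP.
exact: rst_trans h k.
Qed.

Canonical gauss_eqv :=
  EquivRel gauss_eqvb gauss_eqvb_refl gauss_eqvb_sym gauss_eqvb_trans.

Definition virtual_knot : Type := {eq_quot gauss_eqv}.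
HB.instance Definition _ := EqQuotient.on virtual_knot.

Definition knot_of (D : gauss_diagram) : virtual_knot := \pi_virtual_knot D.

Definition unknot : virtual_knot := knot_of (@GaussDiagram [::] isT).

Inductive forbidden_move : seq endpoint -> seq endpoint -> Prop :=
| FO a b u : forbidden_move [:: Tl a, Tl b & u] [:: Tl b, Tl a & u]
| FU a b u : forbidden_move [:: Hd a, Hd b & u] [:: Hd b, Hd a & u].

Inductive unknotted_in : nat -> virtual_knot -> Prop :=
| unknotted_in0 : unknotted_in 0 unknot
| unknotted_inS n (D E : gauss_diagram) :
    forbidden_move D E -> unknotted_in n (knot_of E) ->
    unknotted_in n.+1 (knot_of D).

(* The forbidden number is well defined: with forbidden moves, adjacent
   endpoints of different arrows can always be interchanged, so that every
   arrow can be made isolated and removed. *)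
Definition unknottable (s : seq endpoint) : Prop :=
  exists (h : is_gauss_code s) (n : nat),
    unknotted_in n (knot_of (GaussDiagram h)).

Lemma perm_gauss_code s t : perm_eq s t -> is_gauss_code s = is_gauss_code t.
Proof.
move=> st; rewrite /is_gauss_code (perm_uniq st) (perm_all _ st).
by congr andb; apply: eq_all => e; rewrite (perm_mem st).
Qed.

Lemma gauss_code_add c s : Tl c \notin s -> Hd c \notin s ->
  is_gauss_code [:: Tl c, Hd c & s] = is_gauss_code s.
Proof.
rewrite /is_gauss_code /= !inE => /negPf ct /negPf ch.
rewrite -/(Tl c) -/(Hd c) ct ch !eqxx /= ?orbT /=.
congr andb; first by rewrite xpair_eqE andbF.
apply: eq_in_all => -[a k] es /=; rewrite !inE /Tl /Hd !xpair_eqE /=.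
case: eqP => //= ac; move: es; rewrite ac.
by case: k => es; rewrite es in ct ch.
Qed.

Lemma knot_of_move (D E : gauss_diagram) : gauss_move D E -> knot_of D = knot_of E.
Proof. by move=> m; apply/eqmodP; apply/asboolP; apply: rst_step. Qed.

Lemma unknottable_move s t :
  gauss_move s t -> is_gauss_code s -> unknottable t -> unknottable s.
Proof.
move=> m hs [ht [n h]]; exists hs, n.
by rewrite (@knot_of_move (GaussDiagram hs) (GaussDiagram ht)).
Qed.

Lemma unknottable_moveV s t :
  gauss_move t s -> is_gauss_code s -> unknottable t -> unknottable s.
Proof.
move=> m hs [ht [n h]]; exists hs, n.
by rewrite -(@knot_of_move (GaussDiagram ht) (GaussDiagram hs)).
Qed.

Lemma unknottable_rot u v : unknottable (u ++ v) -> unknottable (v ++ u).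
Proof.
move=> g; have [h _] := g; apply: unknottable_move (gm_rotate _ _) _ g.
by rewrite (@perm_gauss_code _ (u ++ v)) // perm_catC.
Qed.

Lemma unknottable_forbidden a b k u v :
  unknottable (u ++ [:: (b, k), (a, k) & v]) ->
  unknottable (u ++ [:: (a, k), (b, k) & v]).
Proof.
move=> /unknottable_rot /= [ht [n h]].
apply: (@unknottable_rot ([:: (a, k), (b, k) & v])) => /=.
have hs : is_gauss_code [:: (a, k), (b, k) & v ++ u].
  rewrite -(@perm_gauss_code [:: (b, k), (a, k) & v ++ u]) //.
  by rewrite (perm_catCA [:: (b, k)] [:: (a, k)]).
exists hs, n.+1; apply: (@unknotted_inS n _ (GaussDiagram ht)) => //=.
by case: k {h} ht hs => ht hs; [exact: FU | exact: FO].
Qed.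

Lemma fresh_name (s : seq endpoint) : exists n, forall b k, ((n, b), k) \notin s.
Proof.
exists (\max_(e <- s) e.1.1).+1 => b k; apply/negP => h.
have := @leq_bigmax_seq _ s xpredT (fun e => e.1.1) _ h isT.
by rewrite /= ltnn.
Qed.

Ltac perm_count :=
  apply/permP => ?; rewrite /= ?count_cat /= ?count_cat /= ?count_cat /=
    ?count_cat /=;
  rewrite -!plusE; ring.

Lemma gauss_code_add2 n d s t : is_gauss_code s ->
  (forall b k, ((n, b), k) \notin s) ->
  perm_eq [:: Tl (n, d), Hd (n, d), Tl (n, ~~ d), Hd (n, ~~ d) & s] t ->
  is_gauss_code t.
Proof.
move=> hs f p; rewrite -(perm_gauss_code p) !gauss_code_add //.
all: by rewrite ?inE ?negb_or ?f /Tl /Hd ?xpair_eqE ?f; case: d {p}; rewrite /= ?andbF ?f.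
Qed.

Lemma unknottable_R2 c c' hs p q r :
  sign c' = - sign c -> hs = [:: Hd c; Hd c'] \/ hs = [:: Hd c'; Hd c] ->
  is_gauss_code (p ++ q ++ r) ->
  is_gauss_code (p ++ [:: Tl c; Tl c'] ++ q ++ hs ++ r) ->
  unknottable (p ++ q ++ r) <->
  unknottable (p ++ [:: Tl c; Tl c'] ++ q ++ hs ++ r).
Proof.
move=> sc hhs h1 h2.
have m : gauss_move ([:: Tl c; Tl c'] ++ q ++ hs ++ (r ++ p)) (q ++ (r ++ p)).
  case: hhs => ->; first exact: gm_R2_parallel.
  exact: gm_R2_antiparallel.
split=> /unknottable_rot; rewrite -!catA => g; apply: unknottable_rot.
  rewrite -!catA; apply: unknottable_move m _ g.
  by rewrite (perm_gauss_code (permEl (perm_catC p _))) -!catA in h2.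
rewrite -!catA; apply: unknottable_moveV m _ g.
by rewrite (perm_gauss_code (permEl (perm_catC p _))) -!catA in h1.
Qed.

Lemma R2_signs n s : sign (n, s) = - sign (n, ~~ s).
Proof. by case: s; rewrite /sign /negative /= ?opprK. Qed.

Lemma gauss_code_swap p x y q :
  is_gauss_code (p ++ [:: x, y & q]) -> is_gauss_code (p ++ [:: y, x & q]).
Proof. by rewrite -(@perm_gauss_code (p ++ [:: x, y & q])) //; perm_count. Qed.

Lemma swap_tmb a b u v x :
  unknottable (Tl a :: u ++ [:: Hd a, Tl b & v ++ Hd b :: x]) ->
  unknottable (Tl a :: u ++ [:: Tl b, Hd a & v ++ Hd b :: x]).
Proof.
case: a b => na sa [nb sb]; set a := (na, sa); set b := (nb, sb) => gt.
have [ht _] := gt; have [n f] := fresh_name (Tl a :: u ++ [:: Hd a, Tl b & v ++ Hd b :: x]).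
have hs := @gauss_code_swap (Tl a :: u) _ _ _ ht.
pose c := (n, ~~ sb); pose c' := (n, sb).
have hex w : perm_eq [:: Tl c, Hd c, Tl c', Hd c' &
    Tl a :: u ++ [:: Hd a, Tl b & v ++ Hd b :: x]] w -> is_gauss_code w.
  by move=> p; apply: (gauss_code_add2 ht f (d := ~~ sb)); rewrite negbK.
have sc : sign c' = - sign c := R2_signs n sb.
have [sab | sab] := eqVneq sa sb.
- have R q : is_gauss_code (Tl a :: u ++ q ++ v ++ Hd b :: x) ->
    is_gauss_code (Tl a :: Tl c :: Tl c' :: u ++ q ++ v ++ [:: Hd c', Hd c, Hd b & x]) ->
    unknottable (Tl a :: u ++ q ++ v ++ Hd b :: x) <->
    unknottable (Tl a :: Tl c :: Tl c' :: u ++ q ++ v ++ [:: Hd c', Hd c, Hd b & x]).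
    have := @unknottable_R2 c c' [:: Hd c'; Hd c] [:: Tl a] (u ++ q ++ v) (Hd b :: x) sc.
    by rewrite -!catA; apply; right.
  apply/(R [:: Tl b; Hd a]) => //; first by apply: hex; perm_count.
  have m := @gm_R3_tmb (~~ sb) a c b (Tl c' :: u) (v ++ [:: Hd c']) x.
  rewrite /r3_top /r3_mid /r3_bot /swap_if /negative /= sab in m.
  rewrite -!catA /= in m.
  have {}m : gauss_move
    (Tl a :: Tl c :: Tl c' :: u ++ [:: Tl b; Hd a] ++ v ++ [:: Hd c', Hd c, Hd b & x])
    (Tl c :: Tl a :: Tl c' :: u ++ [:: Hd a; Tl b] ++ v ++ [:: Hd c', Hd b, Hd c & x]).
    by case: (sb) m => /=.
  apply: unknottable_move m _ _; first by apply: hex; perm_count.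
  apply: (@unknottable_forbidden c a false [::]).
  have /= := @unknottable_forbidden b c true
    (Tl a :: Tl c :: Tl c' :: u ++ [:: Hd a; Tl b] ++ v ++ [:: Hd c']) x.
  rewrite -!catA /= -!catA /=; apply.
  apply/(R [:: Hd a; Tl b]) => //; by apply: hex; perm_count.
- have R q : is_gauss_code (Tl a :: u ++ q ++ v ++ Hd b :: x) ->
    is_gauss_code (Tl a :: Tl c :: Tl c' :: u ++ q ++ v ++ [:: Hd b, Hd c, Hd c' & x]) ->
    unknottable (Tl a :: u ++ q ++ v ++ Hd b :: x) <->
    unknottable (Tl a :: Tl c :: Tl c' :: u ++ q ++ v ++ [:: Hd b, Hd c, Hd c' & x]).
    have := @unknottable_R2 c c' [:: Hd c; Hd c'] [:: Tl a] (u ++ q ++ v ++ [:: Hd b]) x sc.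
    by rewrite -!catA; apply; left.
  apply/(R [:: Tl b; Hd a]) => //; first by apply: hex; perm_count.
  have m := @gm_R3_tmb (~~ sb) a c b (Tl c' :: u) v (Hd c' :: x).
  rewrite /r3_top /r3_mid /r3_bot /swap_if /negative /= in m.
  rewrite -?catA /= in m.
  have {}m : gauss_move
    (Tl a :: Tl c :: Tl c' :: u ++ [:: Tl b; Hd a] ++ v ++ [:: Hd b, Hd c, Hd c' & x])
    (Tl c :: Tl a :: Tl c' :: u ++ [:: Hd a; Tl b] ++ v ++ [:: Hd c, Hd b, Hd c' & x]).
    by case: (sb) (sa) sab m => -[] /=.
  apply: unknottable_move m _ _; first by apply: hex; perm_count.
  apply: (@unknottable_forbidden c a false [::]).
  have /= := @unknottable_forbidden c b true
    (Tl a :: Tl c :: Tl c' :: u ++ [:: Hd a; Tl b] ++ v) (Hd c' :: x).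
  rewrite -?catA /= -?catA /=; apply.
  apply/(R [:: Hd a; Tl b]) => //; by apply: hex; perm_count.
Qed.

Lemma swap_tbm a b u v x :
  unknottable (Tl a :: u ++ Hd b :: v ++ [:: Hd a, Tl b & x]) ->
  unknottable (Tl a :: u ++ Hd b :: v ++ [:: Tl b, Hd a & x]).
Proof.
case: a b => na sa [nb sb]; set a := (na, sa); set b := (nb, sb) => gt.
have [ht _] := gt.
have [n f] := fresh_name (Tl a :: u ++ Hd b :: v ++ [:: Hd a, Tl b & x]).
have hs : is_gauss_code (Tl a :: u ++ Hd b :: v ++ [:: Tl b, Hd a & x]).
  by move: ht; congr is_true; apply: perm_gauss_code; perm_count.
pose c := (n, ~~ sb); pose c' := (n, sb).
have hex w : perm_eq [:: Tl c, Hd c, Tl c', Hd c' &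
    Tl a :: u ++ Hd b :: v ++ [:: Hd a, Tl b & x]] w -> is_gauss_code w.
  by move=> p; apply: (gauss_code_add2 ht f (d := ~~ sb)); rewrite negbK.
have sc : sign c' = - sign c := R2_signs n sb.
have [sab | sab] := eqVneq sa sb.
- have R q : is_gauss_code (Tl a :: u ++ Hd b :: v ++ q ++ x) ->
    is_gauss_code (Tl a :: Tl c :: Tl c' :: u ++ [:: Hd c', Hd c, Hd b & v ++ q ++ x]) ->
    unknottable (Tl a :: u ++ Hd b :: v ++ q ++ x) <->
    unknottable (Tl a :: Tl c :: Tl c' :: u ++ [:: Hd c', Hd c, Hd b & v ++ q ++ x]).
    have := @unknottable_R2 c c' [:: Hd c'; Hd c] [:: Tl a] u (Hd b :: v ++ q ++ x) sc.
    by rewrite -?catA; apply; right.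
  apply/(R [:: Tl b; Hd a]) => //; first by apply: hex; perm_count.
  have m := @gm_R3_tbm (~~ sb) a c b (Tl c' :: u ++ [:: Hd c']) v x.
  rewrite /r3_top /r3_mid /r3_bot /swap_if /negative /= sab in m.
  rewrite -?catA /= -?catA /= in m.
  have {}m : gauss_move
    (Tl a :: Tl c :: Tl c' :: u ++ [:: Hd c', Hd c, Hd b & v ++ [:: Tl b, Hd a & x]])
    (Tl c :: Tl a :: Tl c' :: u ++ [:: Hd c', Hd b, Hd c & v ++ [:: Hd a, Tl b & x]]).
    by case: (sb) m => /=.
  apply: unknottable_move m _ _; first by apply: hex; perm_count.
  apply: (@unknottable_forbidden c a false [::]).
  have /= := @unknottable_forbidden b c true
    (Tl a :: Tl c :: Tl c' :: u ++ [:: Hd c']) (v ++ [:: Hd a, Tl b & x]).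
  rewrite -?catA /= -?catA /=; apply.
  apply/(R [:: Hd a; Tl b]) => //; by apply: hex; perm_count.
- have R q : is_gauss_code (Tl a :: u ++ Hd b :: v ++ q ++ x) ->
    is_gauss_code (Tl a :: Tl c :: Tl c' :: u ++ [:: Hd b, Hd c, Hd c' & v ++ q ++ x]) ->
    unknottable (Tl a :: u ++ Hd b :: v ++ q ++ x) <->
    unknottable (Tl a :: Tl c :: Tl c' :: u ++ [:: Hd b, Hd c, Hd c' & v ++ q ++ x]).
    have := @unknottable_R2 c c' [:: Hd c; Hd c'] [:: Tl a] (u ++ [:: Hd b]) (v ++ q ++ x) sc.
    by rewrite -?catA; apply; left.
  apply/(R [:: Tl b; Hd a]) => //; first by apply: hex; perm_count.
  have m := @gm_R3_tbm (~~ sb) a c b (Tl c' :: u) (Hd c' :: v) x.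
  rewrite /r3_top /r3_mid /r3_bot /swap_if /negative /= in m.
  have {}m : gauss_move
    (Tl a :: Tl c :: Tl c' :: u ++ [:: Hd b, Hd c, Hd c' & v ++ [:: Tl b, Hd a & x]])
    (Tl c :: Tl a :: Tl c' :: u ++ [:: Hd c, Hd b, Hd c' & v ++ [:: Hd a, Tl b & x]]).
    by case: (sb) (sa) sab m => -[] /=.
  apply: unknottable_move m _ _; first by apply: hex; perm_count.
  apply: (@unknottable_forbidden c a false [::]).
  have /= := @unknottable_forbidden c b true
    (Tl a :: Tl c :: Tl c' :: u) (Hd c' :: v ++ [:: Hd a, Tl b & x]).
  apply.
  apply/(R [:: Hd a; Tl b]) => //; by apply: hex; perm_count.
Qed.

Lemma gauss_code_mem s e : is_gauss_code s -> e \in s -> (e.1, ~~ e.2) \in s.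
Proof. by case/andP => _ /allP; apply. Qed.

Lemma swap_tail_head a b p q : a != b ->
  unknottable (p ++ [:: Hd a, Tl b & q]) ->
  unknottable (p ++ [:: Tl b, Hd a & q]).
Proof.
move=> ab /unknottable_rot /=; set w := q ++ p => gt.
apply: (@unknottable_rot [:: Tl b, Hd a & q] p); rewrite /= -/w.
have [ht _] := gt.
have aw : Tl a \in w.
  have := gauss_code_mem ht (mem_head (Hd a) _).
  by rewrite !inE /Tl /Hd !xpair_eqE (negPf ab) /= andbF.
have bw : Hd b \in w.
  have /(gauss_code_mem ht) : Tl b \in [:: Hd a, Tl b & w] by rewrite !inE eqxx orbT.
  by rewrite !inE /Tl /Hd !xpair_eqE (eq_sym b) (negPf ab) /= andbF.
case/splitPr: aw bw gt {ht} => u v; rewrite mem_cat inE xpair_eqE andbF /= => /orP[].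
- case/splitPr => x y gt.
  apply: (@unknottable_rot (Tl a :: v) ([:: Tl b, Hd a & x ++ Hd b :: y])).
  apply: swap_tmb.
  exact: (@unknottable_rot ([:: Hd a, Tl b & x ++ Hd b :: y]) (Tl a :: v)).
- case/splitPr => x y gt.
  apply: (@unknottable_rot (Tl a :: x ++ Hd b :: y) ([:: Tl b, Hd a & u])).
  rewrite /= -catA /=; apply: swap_tbm.
  have /= := @unknottable_rot ([:: Hd a, Tl b & u]) (Tl a :: x ++ Hd b :: y) gt.
  by rewrite -catA.
Qed.

Lemma unknottable_slide a u v : (forall k, (a, k) \notin u) ->
  unknottable [:: Tl a, Hd a & u ++ v] -> unknottable (Tl a :: u ++ Hd a :: v).
Proof.
elim/last_ind: u v => [|u [b k] IHu] v //= au; rewrite !cat_rcons => g.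
have ab : a != b by have := au k; rewrite mem_rcons inE xpair_eqE eqxx andbT negb_or => /andP[].
have {}g : unknottable (Tl a :: u ++ Hd a :: (b, k) :: v).
  by apply: IHu => // k'; have := au k'; rewrite mem_rcons inE negb_or => /andP[].
case: k {au} g => g; first exact: (@unknottable_forbidden b a true (Tl a :: u)).
exact: (@swap_tail_head a b (Tl a :: u)).
Qed.

Lemma gauss_code_unknottable s : is_gauss_code s -> unknottable s.
Proof.
have [n] := ubnP (size s); elim: n s => // n IHn [|[a k] w] sn hs.
  exists hs, 0; rewrite (_ : GaussDiagram hs = GaussDiagram (isT : is_gauss_code [::])).
    exact: unknotted_in0.
  exact: val_inj.
have : Tl a \in (a, k) :: w.
  by case: k hs {sn} => // hs; [exact: gauss_code_mem hs (mem_head _ _) | exact: mem_head].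
move: ((a, k) :: w) sn hs => {w k} s sn hs /splitPr sE; case: sE sn hs => p q sn hs.
apply: (@unknottable_rot (Tl a :: q)).
have {}hs : is_gauss_code (Tl a :: q ++ p).
  by rewrite -(perm_gauss_code (permEl (perm_catC p (Tl a :: q)))).
have {}sn : (size (Tl a :: q ++ p) < n.+1)%N by move: sn; rewrite /= !size_cat /= addnS addnC.
rewrite /=; move: (q ++ p) hs sn => {p q} w hs sn.
have : Hd a \in w.
  by have := gauss_code_mem hs (mem_head _ _); rewrite inE xpair_eqE andbF.
move/splitPr=> wE; case: wE hs sn => u v hs sn.
have hs' : is_gauss_code [:: Tl a, Hd a & u ++ v].
  by rewrite -(@perm_gauss_code (Tl a :: u ++ Hd a :: v)) //; perm_count.
have /andP[] := hs'; rewrite /= !inE !negb_or => /and3P[/andP[_ ta] ha _] _.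
apply: unknottable_slide.
  by move=> k; move: ta ha; rewrite !mem_cat !negb_or; case: k => /andP[] ? _ /andP[].
apply: (unknottable_move (gm_R1_tail_first _ _) hs'); apply: IHn.
  by move: sn; rewrite /= !size_cat /= addnS => /ltnW.
by rewrite -(gauss_code_add ta ha).
Qed.

Lemma forbidden_number_exists (K : virtual_knot) :
  exists n, `[< unknotted_in n K >].
Proof.
elim/quotW: K => D; have [h [n hn]] := gauss_code_unknottable (codeP D).
by exists n; apply/asboolP; rewrite (_ : D = GaussDiagram h) //; apply: val_inj.
Qed.

Definition forbidden_number (K : virtual_knot) : nat :=
  ex_minn (forbidden_number_exists K).

(* [rot k s] reads the diagram once around, starting in the arc that precedes
   the endpoint number [k]. *)
Definition arrows (s : seq endpoint) : seq arrow := [seq e.1 | e <- s & e.2].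

Definition arc_label (s : seq endpoint) (k : nat) : int :=
  \sum_(a <- arrows s | (index (Hd a) (rot k s) < index (Tl a) (rot k s))%N)
    sign a.

Definition odd_arrow (s : seq endpoint) (a : arrow) : bool :=
  let i := index (Tl a) s in
  let j := index (Hd a) s in
  odd (maxn i j - minn i j).-1.

(* The arcs incident to the endpoint number [k] are the arcs [k] and [k.+1];
   when [k] is the last endpoint, [rot k.+1 s = s = rot 0 s]. *)
Definition arrow_index (s : seq endpoint) (a : arrow) : int :=
  let h := index (Hd a) s in
  let t := index (Tl a) s in
  Num.max (arc_label s h) (arc_label s h.+1) -
    Num.min (arc_label s t) (arc_label s t.+1).

(* [{malg int[int]}] is the group of finitely supported functions int -> int,
   i.e. Z[t, t^-1], with [<< b *g i >>] standing for b t^i and [W@_i] for the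
   coefficient of t^i in W. *)
Definition odd_writhe_polynomial (D : gauss_diagram) : {malg int[int]} :=
  \sum_(a <- arrows D | odd_arrow D a) << sign a *g arrow_index D a >>.

(* Main.v *)
Require Import Defs.
From mathcomp Require Import all_boot all_order all_algebra generic_quotient.
From mathcomp Require Import finmap.
From mathcomp Require Import monalg.
From mathcomp Require Import boolp zify ring.

Set Implicit Arguments.
Unset Strict Implicit.
Unset Printing Implicit Defensive.

Import Order.TTheory GRing.Theory Num.Theory.

Local Open Scope ring_scope.

(** Read a Gauss code from its base point and keep a running total, the height,
    that goes up by the sign of an arrow at its tail and down by it at its
    head.  Passing an endpoint changes the label of the current arc by exactly
    this amount, because the arrow passed, met first at that endpoint until
    then, is now met first at its other endpoint.  So the label of an arc is
    the height plus a constant, and for either sign of the crossing c the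
    maximum and the minimum in the definition of N(c) give
      N(c) = height (head of c) - height (tail of c) - sign c + 1
    ([arrow_indexE]).  Since every endpoint contributes +1 or -1, a crossing is
    odd exactly when N(c) is even ([odd_arrowE]).  The odd writhe polynomial is
    therefore the sum of sign c t^N(c) over the arrows c with N(c) even, a
    quantity that depends on heights only ([odd_writhe]).

    Invariance follows by following heights through each move.  A change of
    base point adds the same constant to all heights, as the total over a
    Gauss code is 0.  The arrow of an R1 move has N = 1, which is odd, so its
    term is 0; the two arrows of an R2 move have the same N and opposite
    signs; and in an R3 move the changes made by the three transpositions of
    adjacent endpoints cancel in N of each of the three arrows.

    A forbidden move transposes two adjacent endpoints of arrows a and b.  It
    shifts N(a) and N(b) by 1 or -1 each and leaves every other N alone.  Hence both parities flip: for each of a and b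
    exactly one of the terms before and after the move is present, and the
    l1-norm of the polynomial, the sum of the absolute values of its
    coefficients, changes by at most 2 ([forbidden_move_norm]).  The unknot
    has norm 0, so a knot unknotted by n forbidden moves has norm at most
    2n. *)

(** * Heights of endpoints and indices of chords *)

Definition endpoint_sign (e : endpoint) : int :=
  if e.2 then - sign e.1 else sign e.1.

Definition weight (s : seq endpoint) : int := \sum_(e <- s) endpoint_sign e.

Definition height (s : seq endpoint) (e : endpoint) : int :=
  weight (take (index e s) s).

(** The exponent N(c) of Cheng's polynomial, see [arrow_indexE]; this form
    treats both orders of head and tail and both signs uniformly. *)
Definition chord_index (s : seq endpoint) (a : arrow) : int :=
  height s (Hd a) - height s (Tl a) - sign a + 1.

(** Testing the parity of the index itself, rather than the number of endpoints
    between head and tail, makes the term a function of heights alone. *)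
Definition crossing_term (s : seq endpoint) (a : arrow) : {malg int[int]} :=
  if odd (absz (chord_index s a)) then 0
  else << sign a *g chord_index s a >>.

Definition odd_writhe (s : seq endpoint) : {malg int[int]} :=
  \sum_(a <- arrows s) crossing_term s a.

Lemma sign_cases a : sign a = 1 \/ sign a = -1.
Proof. by rewrite /sign; case: ifP; [right | left]. Qed.

Lemma weight_cons e s : weight (e :: s) = endpoint_sign e + weight s.
Proof. exact: big_cons. Qed.

Lemma weight_cat u v : weight (u ++ v) = weight u + weight v.
Proof. exact: big_cat. Qed.

Lemma height_cons x s e :
  height (x :: s) e = if x == e then 0 else endpoint_sign x + height s e.
Proof.
by rewrite /height /=; case: ifP => _; rewrite ?weight_cons // /weight big_nil.
Qed.

Lemma height_cat u v e :
  height (u ++ v) e = if e \in u then height u e else weight u + height v e.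
Proof.
elim: u => [|x u IHu] /=; first by rewrite /weight big_nil add0r.
rewrite !height_cons inE (eq_sym e) weight_cons IHu.
by case: eqP => //= _; case: ifP; rewrite // addrA.
Qed.

Lemma odd_abszD x y : odd (absz (x + y)) = odd (absz x) (+) odd (absz y).
Proof. lia. Qed.

Lemma odd_weight s : odd (absz (weight s)) = odd (size s).
Proof.
elim: s => [|e s IHs]; first by rewrite /weight big_nil.
rewrite weight_cons odd_abszD IHs /endpoint_sign.
by case: ifP => _; case: (sign_cases e.1) => ->.
Qed.

Lemma odd_height s e : odd (absz (height s e)) = odd (index e s).
Proof. by rewrite odd_weight size_takel // index_size. Qed.

(** * Gauss codes *)

Lemma perm_arrows s t : perm_eq s t -> perm_eq (arrows s) (arrows t).
Proof. by move=> st; apply/perm_map/perm_filter. Qed.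

Lemma mem_arrows s a : (a \in arrows s) = (Hd a \in s).
Proof.
apply/mapP/idP => [[[b k]] | h]; last by exists (Hd a); rewrite // mem_filter.
by rewrite mem_filter /= => /andP[kT bs] ->; move: bs; rewrite kT.
Qed.

Lemma arrows_uniq s : uniq s -> uniq (arrows s).
Proof.
move=> us; rewrite map_inj_in_uniq ?filter_uniq // => -[a k] [b l].
by rewrite !mem_filter /= => /andP[-> _] /andP[-> _] ->.
Qed.

Lemma code_uniq s : is_gauss_code s -> uniq s.
Proof. by case/andP. Qed.

Lemma code_mem s a k l : is_gauss_code s -> (a, k) \in s -> (a, l) \in s.
Proof.
move=> hs h; have [<- //|kl] := eqVneq k l.
by have := gauss_code_mem hs h; rewrite /=; case: k l kl {h} => -[].
Qed.

(** Exchanging the head and the tail of every arrow permutes a Gauss code and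
    negates its weight. *)
Lemma code_weight s : is_gauss_code s -> weight s = 0.
Proof.
move=> hs; pose flip (e : endpoint) : endpoint := (e.1, ~~ e.2).
have flipK : involutive flip by case=> a k; rewrite /flip /= negbK.
have p : perm_eq s (map flip s).
  apply: uniq_perm; rewrite ?(map_inj_uniq (inv_inj flipK)) ?code_uniq //.
  move=> e; apply/idP/mapP => [es | [f fs ->]]; last exact: gauss_code_mem.
  by exists (flip e); rewrite ?flipK //; apply: gauss_code_mem.
have : weight s = - weight s.
  rewrite {1}/weight (perm_big _ p) big_map -sumrN.
  apply: eq_bigr => -[a k] _; rewrite /endpoint_sign /=.
  by case: k; rewrite ?opprK.
lia.
Qed.

(** * The odd writhe polynomial in terms of chord indices *)

(** The label of the arc that contains the base point. *)
Definition base_label (s : seq endpoint) : int :=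
  \sum_(a <- arrows s | (index (Hd a) s < index (Tl a) s)%N) sign a.

(** Only the arrow of the endpoint that is passed can have its order of head and
    tail reversed. *)
Lemma base_label_step x r : is_gauss_code (x :: r) ->
  base_label (rcons r x) = base_label (x :: r) + endpoint_sign x.
Proof.
move=> hs; have us := code_uniq hs; case: x hs us => a k hs us.
have aA : a \in arrows ((a, k) :: r).
  by rewrite mem_arrows (@code_mem _ _ k) // mem_head.
have p : perm_eq (arrows (rcons r (a, k))) (arrows ((a, k) :: r)).
  by apply: perm_arrows; rewrite perm_rcons.
have uA := arrows_uniq us.
rewrite /base_label (perm_big _ p) /= big_mkcond [in RHS]big_mkcond.
rewrite !(bigD1_seq a aA uA) /= addrAC; congr (_ + _).
  have /andP[xr _] := us.
  have : (a, ~~ k) \in r.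
    have := code_mem (~~ k) hs (mem_head _ _).
    by rewrite inE xpair_eqE eqxx; case: (k).
  rewrite -!cats1 !index_cat /=.
  case: k xr {hs us aA p uA} => xr yr; rewrite /endpoint_sign /= (negPf xr) yr /=;
    rewrite /Tl /Hd !xpair_eqE !eqxx /= addn0.
    by rewrite ltnNge ltnW ?index_mem //= subrr.
  by rewrite index_mem yr add0r.
rewrite big_seq_cond [in RHS]big_seq_cond; apply: eq_bigr => b /andP[bA ba].
have mr l : (b, l) \in r.
  have: (b, l) \in (a, k) :: r.
    by apply: (@code_mem _ _ true) => //; rewrite mem_arrows in bA.
  by rewrite inE xpair_eqE (negPf ba).
rewrite -cats1 !index_cat !mr /= !xpair_eqE (eq_sym a) (negPf ba) /=.
by rewrite ltnS.
Qed.

Lemma arc_label_weight s k : is_gauss_code s -> (k <= size s)%N ->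
  arc_label s k = base_label s + weight (take k s).
Proof.
move=> hs; have -> n : arc_label s n = base_label (rot n s).
  by apply: perm_big; apply: perm_arrows; rewrite perm_sym perm_rot.
elim: k => [|k IHk] ks; first by rewrite rot0 take0 /weight big_nil addr0.
pose x0 : endpoint := ((0%N, false), false).
rewrite (take_nth x0 ks) -cats1 weight_cat addrA -IHk ?(ltnW ks) //.
rewrite /weight big_seq1 /rot (take_nth x0 ks) (drop_nth x0 ks) /=.
rewrite -base_label_step.
  by rewrite -rcons_cat.
rewrite -cat_cons -drop_nth //.
by rewrite (@perm_gauss_code _ s) // -/(rot k s) perm_rot.
Qed.

(** The two arcs at an endpoint e are labelled L and L + [endpoint_sign e].  At
    the head the maximum is L for a positive arrow and L + 1 for a negative
    one; at the tail the minimum is L and L - 1 respectively. *)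
Lemma arrow_indexE s a : is_gauss_code s -> a \in arrows s ->
  arrow_index s a = chord_index s a.
Proof.
move=> hs; rewrite mem_arrows => hH.
have hT : Tl a \in s by apply: code_mem hH.
have E e : e \in s -> arc_label s (index e s) = base_label s + height s e /\
    arc_label s (index e s).+1 = base_label s + height s e + endpoint_sign e.
  move=> es; rewrite !arc_label_weight ?index_mem ?index_size //; split=> //.
  rewrite (take_nth e) ?index_mem // nth_index // -cats1 weight_cat addrA.
  by rewrite [weight [:: e]]big_seq1.
rewrite /arrow_index; have [-> ->] := E _ hH; have [-> ->] := E _ hT.
rewrite /chord_index /endpoint_sign /=.
by case: (sign_cases a) => ->; lia.
Qed.

Lemma odd_distn_pred i j : i != j ->
  odd (maxn i j - minn i j).-1 = ~~ (odd i (+) odd j).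
Proof.
by case: ltngtP => // ij _;
  rewrite -subn1 oddB ?subn_gt0 // oddB ?(ltnW ij) // addbT // addbC.
Qed.

(** The height of an endpoint has the parity of its position, as it is a sum of
    units, one for each earlier endpoint. *)
Lemma odd_arrowE s a : is_gauss_code s -> a \in arrows s ->
  odd_arrow s a = ~~ odd (absz (chord_index s a)).
Proof.
move=> hs; rewrite mem_arrows => hH.
have hT : Tl a \in s by apply: code_mem hH.
have ne : index (Tl a) s != index (Hd a) s.
  by apply/eqP => /(index_inj (Hd a) hT hH).
rewrite /odd_arrow odd_distn_pred // /chord_index !odd_abszD !abszN !odd_height.
by rewrite addbC; case: (sign_cases a) => -> /=; rewrite !addbT negbK.
Qed.

Lemma odd_writhe_polynomialE D : odd_writhe_polynomial D = odd_writhe D.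
Proof.
rewrite /odd_writhe_polynomial /odd_writhe big_mkcond !big_seq.
apply: eq_bigr => a aD; rewrite /crossing_term.
by rewrite odd_arrowE ?arrow_indexE ?codeP //; case: odd.
Qed.

(** * Invariance under the moves of Gauss diagrams *)

(** The common shape of the invariance proofs: [r] lists the arrows removed by the
    move. *)
Lemma eq_writhe s t r : perm_eq (arrows s) (r ++ arrows t) ->
  {in arrows t, chord_index s =1 chord_index t} ->
  \sum_(a <- r) crossing_term s a = 0 -> odd_writhe s = odd_writhe t.
Proof.
move=> p E r0; rewrite /odd_writhe (perm_big _ p) big_cat /= r0 add0r.
by rewrite !big_seq; apply: eq_bigr => a /E; rewrite /crossing_term => ->.
Qed.

(** Since the weights of [u] and [v] are opposite, moving [u] to the end shifts
    the heights in both words by the same amount. *)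
Lemma writhe_rotate u v : is_gauss_code (u ++ v) ->
  odd_writhe (u ++ v) = odd_writhe (v ++ u).
Proof.
move=> hs; apply: (@eq_writhe _ _ [::]); rewrite ?big_nil //.
  by apply: perm_arrows; rewrite perm_catC.
have w0 : weight v = - weight u.
  by have := code_weight hs; rewrite weight_cat addrC => /eqP; rewrite addr_eq0 => /eqP.
move: (code_uniq hs); rewrite cat_uniq => /and3P[_ /hasPn dis _].
have E e : e \in u ++ v -> height (u ++ v) e = height (v ++ u) e + weight u.
  rewrite mem_cat !height_cat; case: ifP => eu /= ev.
    case: ifP => [/dis|_]; first by rewrite /= eu.
    by rewrite w0; ring.
  by rewrite ev addrC.
have hvu : is_gauss_code (v ++ u).
  by rewrite -(@perm_gauss_code (u ++ v)) // perm_catC.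
move=> a; rewrite mem_arrows => ha; have hb : Tl a \in v ++ u by apply: code_mem ha.
rewrite /chord_index !E 1?mem_cat 1?orbC -?mem_cat //; ring.
Qed.

Lemma writhe_rename f u : injective f -> (forall a, sign (f a) = sign a) ->
  odd_writhe [seq (f e.1, e.2) | e <- u] = odd_writhe u.
Proof.
move=> fI fs; pose g (e : endpoint) : endpoint := (f e.1, e.2).
have gI : injective g by move=> [a k] [b l] [/fI -> ->].
have E e : height (map g u) (g e) = height u e.
  rewrite /height /weight index_map // -map_take big_map.
  by apply: eq_bigr => x _; rewrite /endpoint_sign /= fs.
have A : arrows (map g u) = map f (arrows u).
  by rewrite /arrows filter_map -!map_comp.
rewrite /odd_writhe -/(map g u) A big_map; apply: eq_bigr => a _.
rewrite /crossing_term; suff -> : chord_index (map g u) (f a) = chord_index u a.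
  by rewrite fs.
by rewrite /chord_index -(E (Hd a)) -(E (Tl a)) fs.
Qed.

Lemma height_skip u w v e : weight w = 0 -> e \notin w ->
  height (u ++ w ++ v) e = height (u ++ v) e.
Proof. by move=> w0 /negPf ew; rewrite !height_cat ew w0 add0r. Qed.

Lemma weight_pair x y : weight [:: x; y] = endpoint_sign x + endpoint_sign y.
Proof. by rewrite !weight_cons /weight big_nil addr0. Qed.

(** The isolated arrow has index 1, which is odd. *)
Lemma writhe_R1 a k u : is_gauss_code [:: (a, k), (a, ~~ k) & u] ->
  odd_writhe [:: (a, k), (a, ~~ k) & u] = odd_writhe u.
Proof.
move=> hs; have us := code_uniq hs.
apply: (@eq_writhe _ _ [:: a]); first by case: k {hs us}.
- move=> b; rewrite mem_arrows => hb.
  have ba : b != a.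
    apply/eqP => ba; move: us; rewrite -ba /= !inE !negb_or.
    by case: k {hs} => /and3P[/andP[_ h] h' _]; [move: h | move: h'];
      rewrite -/(Hd b) hb.
  have H e : e.1 = b -> height [:: (a, k), (a, ~~ k) & u] e = height u e.
    case: e => c l /= ->; apply: (@height_skip [::] [:: (a, k); (a, ~~ k)]).
      rewrite weight_pair /endpoint_sign /=.
      by case: (k) => /=; rewrite ?addNr ?addrN.
    by rewrite !inE !xpair_eqE (negPf ba).
  by rewrite /chord_index !H.
rewrite big_seq1 /crossing_term /chord_index !height_cons !xpair_eqE !eqxx /=.
by rewrite /endpoint_sign; case: k {hs us} => /=; case: (sign_cases a) => ->.
Qed.

(** The two arrows have equal indices and opposite signs; each of the two removed
    words has weight 0, so no other height changes.  The flag [k] tells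
    antiparallel strands from parallel ones. *)
Lemma writhe_R2 a b k u v : sign b = - sign a ->
  let hs := if k then [:: Hd b; Hd a] else [:: Hd a; Hd b] in
  is_gauss_code ([:: Tl a; Tl b] ++ u ++ hs ++ v) ->
  odd_writhe ([:: Tl a; Tl b] ++ u ++ hs ++ v) = odd_writhe (u ++ v).
Proof.
move=> sb hs hc; have uc := code_uniq hc.
set s := _ ++ _ in hc uc *.
have p : perm_eq s [:: Tl a, Tl b, Hd a, Hd b & u ++ v].
  apply/permP => P; rewrite /s /hs; case: (k) => /=; rewrite !count_cat /=; lia.
have uc' := uc; rewrite (perm_uniq p) in uc'.
have sum0 : weight [:: Hd a; Hd b] = 0.
  by rewrite weight_pair /endpoint_sign /= sb; ring.
apply: (@eq_writhe _ _ [:: a; b]).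
- exact: perm_arrows p.
- move=> c; rewrite mem_arrows => hb.
  move: uc' => /= /and5P[_ _ h1 h2 _].
  have ca : c != a.
    by apply: contraNneq h1 => <-; rewrite inE hb orbT.
  have cb : c != b by apply: contraNneq h2 => <-.
  have H e : e.1 = c -> height s e = height (u ++ v) e.
    case: e => d l /= ->.
    rewrite -[in RHS](@height_skip u hs v).
    + apply: (@height_skip [::] [:: Tl a; Tl b]).
        by rewrite weight_pair /endpoint_sign /= sb addrN.
      by rewrite !inE !xpair_eqE (negPf ca) (negPf cb).
    + by rewrite /hs; case: (k) => //; rewrite weight_pair addrC -weight_pair.
    + by rewrite /hs; case: (k); rewrite !inE !xpair_eqE (negPf ca) (negPf cb).
  by rewrite /chord_index !H.
have [ab na nb] : [/\ a != b, Hd a \notin u & Hd b \notin u].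
  move: uc'; rewrite /= !inE !mem_cat !negb_or.
  case/and5P=> /and4P[ab _ _ _] _ /and3P[_ -> _] /andP[-> _] _; split=> //.
  by case/andP: ab.
have E : chord_index s a = chord_index s b.
  have ba : (b == a) = false by rewrite eq_sym (negPf ab).
  rewrite /chord_index /s /hs; case: (k);
    rewrite /= !(height_cons, height_cat) (negPf na) (negPf nb);
    rewrite /Tl /Hd !xpair_eqE !eqxx (negPf ab) ba /=;
    rewrite /endpoint_sign /= sb; ring.
rewrite !big_cons big_nil addr0 /crossing_term E; case: ifP => _; rewrite ?addr0 //.
by rewrite sb monalgUN addrN.
Qed.

Lemma height_swap u x y v e : uniq (u ++ [:: x, y & v]) ->
  height (u ++ [:: y, x & v]) e =
  height (u ++ [:: x, y & v]) e
    + (endpoint_sign y *+ (e == x) - endpoint_sign x *+ (e == y)).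
Proof.
rewrite cat_uniq /= !inE !negb_or => /and3P[_ /and3P[xu yu _] /andP[/andP[xy _] _]].
rewrite !height_cat; case: ifP => eu.
  have /negPf -> : e != x by apply: contraNneq xu => <-.
  have /negPf -> : e != y by apply: contraNneq yu => <-.
  by rewrite subrr addr0.
rewrite !height_cons !(eq_sym _ e).
have [ex|_] := eqVneq e x; last by case: eqP => _; rewrite ?mulr0n ?mulr1n; ring.
by rewrite ex (negPf xy) /= mulr0n mulr1n; ring.
Qed.

(** The change in the height of [e] when the word [swap_if b x y] is replaced by
    [swap_if (~~ b) x y]. *)
Definition swap_gain (b : bool) (x y e : endpoint) : int :=
  (-1) ^+ b * (endpoint_sign y *+ (e == x) - endpoint_sign x *+ (e == y)).

Lemma height_swap_if b u x y v e : uniq (u ++ swap_if b x y ++ v) ->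
  height (u ++ swap_if (~~ b) x y ++ v) e =
  height (u ++ swap_if b x y ++ v) e
    + swap_gain b x y e.
Proof.
rewrite /swap_gain; case: b => /= us; rewrite height_swap // ?expr1 ?expr0 ?mul1r //.
by congr (_ + _); ring.
Qed.

Lemma perm_swap_if b c x y : perm_eq (swap_if b x y) (swap_if c x y).
Proof. by case: b c => -[]; rewrite // (perm_catC [:: _] [:: _]). Qed.

(** The three strands of an R3 move, with the order of each pair of adjacent
    endpoints left free; it covers both cyclic orders of the strands. *)
Definition triple_swap (x1 y1 x2 y2 x3 y3 : endpoint) (u v w : seq endpoint)
    (b1 b2 b3 : bool) : seq endpoint :=
  swap_if b1 x1 y1 ++ u ++ swap_if b2 x2 y2 ++ v ++ swap_if b3 x3 y3 ++ w.

Lemma perm_triple_swap x1 y1 x2 y2 x3 y3 u v w b1 b2 b3 c1 c2 c3 :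
  let s := triple_swap x1 y1 x2 y2 x3 y3 u v w in
  perm_eq (s b1 b2 b3) (s c1 c2 c3).
Proof.
do 2![apply: perm_cat; [exact: perm_swap_if | rewrite perm_cat2l]].
by rewrite perm_cat2r perm_swap_if.
Qed.

Lemma height_triple_swap x1 y1 x2 y2 x3 y3 u v w b1 b2 b3 e :
  let s := triple_swap x1 y1 x2 y2 x3 y3 u v w in
  uniq (s b1 b2 b3) ->
  height (s (~~ b1) (~~ b2) (~~ b3)) e =
  height (s b1 b2 b3) e + swap_gain b1 x1 y1 e + swap_gain b2 x2 y2 e
    + swap_gain b3 x3 y3 e.
Proof.
move=> s us.
have U c1 c2 c3 : uniq (s c1 c2 c3).
  by rewrite (perm_uniq (perm_triple_swap _ _ _ _ _ _ _ _ _ _ _ _ b1 b2 b3)).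
have S1 : height (s (~~ b1) b2 b3) e = height (s b1 b2 b3) e + swap_gain b1 x1 y1 e.
  exact: (@height_swap_if b1 [::]).
have S2 : height (s (~~ b1) (~~ b2) b3) e =
    height (s (~~ b1) b2 b3) e + swap_gain b2 x2 y2 e.
  rewrite /s /triple_swap [in LHS]catA [in RHS]catA.
  by apply: height_swap_if; rewrite -catA; apply: U.
have S3 : height (s (~~ b1) (~~ b2) (~~ b3)) e =
    height (s (~~ b1) (~~ b2) b3) e + swap_gain b3 x3 y3 e.
  have E b : s (~~ b1) (~~ b2) b = (swap_if (~~ b1) x1 y1 ++ u ++
    swap_if (~~ b2) x2 y2 ++ v) ++ swap_if b x3 y3 ++ w.
    by rewrite /s /triple_swap -!catA.
  by rewrite !E; apply: height_swap_if; rewrite -E; apply: U.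
by rewrite S3 S2 S1.
Qed.

(** If head and tail of every arrow gain the same height, then no index
    changes. *)
Lemma writhe_triple_swap x1 y1 x2 y2 x3 y3 u v w b1 b2 b3 :
  let s := triple_swap x1 y1 x2 y2 x3 y3 u v w in
  let D e := swap_gain b1 x1 y1 e + swap_gain b2 x2 y2 e
    + swap_gain b3 x3 y3 e in
  (forall a, D (Hd a) = D (Tl a)) ->
  uniq (s b1 b2 b3) ->
  odd_writhe (s b1 b2 b3) = odd_writhe (s (~~ b1) (~~ b2) (~~ b3)).
Proof.
move=> s D Da us; apply: (@eq_writhe _ _ [::]); last by rewrite big_nil.
  exact/perm_arrows/perm_triple_swap.
have H e : height (s (~~ b1) (~~ b2) (~~ b3)) e = height (s b1 b2 b3) e + D e.
  by rewrite height_triple_swap // /D !addrA.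
move=> a _; rewrite /chord_index !H Da; ring.
Qed.

(** Each R3 arrow takes part in one transposition at its tail and one at its
    head, with different partners, and gains the same height at both: (-1)^d
    for [tm], - (-1)^d sign tm sign tb for [tb], and (-1)^d sign tm sign mb for
    [mb].  The signs that fix the orders along the strands are exactly what
    makes the two gains agree. *)
Lemma r3_gain_balance d tm tb mb a :
  let D e := swap_gain (d (+) negative tb) (Tl tm) (Tl tb) e
    + swap_gain (d (+) negative mb) (Hd tm) (Tl mb) e
    + swap_gain (d (+) negative tm (+) negative tb (+) negative mb)
        (Hd tb) (Hd mb) e in
  D (Hd a) = D (Tl a).
Proof.
rewrite /swap_gain /Tl /Hd !xpair_eqE !andbT !andbF /endpoint_sign /=.
rewrite !mulr0n /sign !signr_addb.
by do 3!(case: (negative _)); rewrite /= ?expr0 ?expr1 ?mulNrn; ring.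
Qed.

Lemma writhe_R3_tmb d tm tb mb u v w :
  let s d := r3_top d tm tb mb ++ u ++ r3_mid d tm tb mb ++ v ++
    r3_bot d tm tb mb ++ w in
  uniq (s d) -> odd_writhe (s d) = odd_writhe (s (~~ d)).
Proof.
rewrite /r3_top /r3_mid /r3_bot !addNb.
by apply: writhe_triple_swap => a; apply: r3_gain_balance.
Qed.

Lemma writhe_R3_tbm d tm tb mb u v w :
  let s d := r3_top d tm tb mb ++ u ++ r3_bot d tm tb mb ++ v ++
    r3_mid d tm tb mb ++ w in
  uniq (s d) -> odd_writhe (s d) = odd_writhe (s (~~ d)).
Proof.
rewrite /r3_top /r3_mid /r3_bot !addNb.
apply: writhe_triple_swap => a; rewrite addrAC [RHS]addrAC.
exact: r3_gain_balance.
Qed.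

Lemma writhe_move (D E : gauss_diagram) :
  gauss_move D E -> odd_writhe D = odd_writhe E.
Proof.
move=> m; have := codeP D; move: m; move: (code D) (code E) => s t.
case=> {s t}.
- exact: writhe_rotate.
- by move=> f u fI fs _; rewrite writhe_rename.
- by move=> a u; apply: (@writhe_R1 a false).
- by move=> a u; apply: (@writhe_R1 a true).
- by move=> a b u v sb; apply: (@writhe_R2 a b false).
- by move=> a b u v sb; apply: (@writhe_R2 a b true).
- by move=> d tm tb mb u v w /code_uniq; apply: writhe_R3_tmb.
- by move=> d tm tb mb u v w /code_uniq; apply: writhe_R3_tbm.
Qed.

Lemma writhe_knot (D E : gauss_diagram) :
  knot_of D = knot_of E -> odd_writhe D = odd_writhe E.
Proof.
move/eqmodP/asboolP; elim=> {D E} //.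
- by move=> D E /writhe_move.
- by move=> D E G _ -> _ ->.
Qed.

(** * The effect of forbidden moves *)

Definition coef_norm (W : {malg int[int]}) : int := \sum_(i <- msupp W) `|W@_i|.

Lemma coef_normE (W : {malg int[int]}) (A : {fset int}) :
  (msupp W `<=` A)%fset -> coef_norm W = \sum_(i <- A) `|W@_i|.
Proof.
move=> WA; apply: big_fset_incl => // i _ /mcoeff_outdom ->.
by rewrite normr0.
Qed.

Lemma coef_norm0 : coef_norm 0 = 0.
Proof. by rewrite /coef_norm msupp0 big_seq_fset0. Qed.

Lemma coef_normN W : coef_norm (- W) = coef_norm W.
Proof.
by rewrite /coef_norm msuppN; apply: eq_bigr => i _; rewrite mcoeffN normrN.
Qed.

Lemma coef_normD V W : coef_norm (V + W) <= coef_norm V + coef_norm W.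
Proof.
rewrite (coef_normE (msuppD_le V W)) (coef_normE (fsubsetUl (msupp V) (msupp W))).
rewrite (coef_normE (fsubsetUr (msupp V) (msupp W))) -big_split.
by apply: ler_sum => i _; rewrite mcoeffD ler_normD.
Qed.

Lemma coef_normU (c k : int) : coef_norm << c *g k >> = `|c|.
Proof. by rewrite (coef_normE msuppU_le) big_seq_fset1 mcoeffUU. Qed.

(** When the parity flips, one of the two terms is 0 and the other is a single
    monomial with coefficient 1 or -1. *)
Lemma coef_norm_termB s t a :
  odd (absz (chord_index s a)) = ~~ odd (absz (chord_index t a)) ->
  coef_norm (crossing_term s a - crossing_term t a) <= 1.
Proof.
rewrite /crossing_term => ->; case: odd; rewrite ?subr0 ?sub0r ?coef_normN coef_normU;
  by case: (sign_cases a) => ->.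
Qed.

(** Only the indices of [a] and [b] change, and each of them by 1 or -1. *)
Lemma forbidden_move_norm a b k u :
  is_gauss_code [:: (a, k), (b, k) & u] ->
  coef_norm (odd_writhe [:: (a, k), (b, k) & u] -
    odd_writhe [:: (b, k), (a, k) & u]) <= 2.
Proof.
set s := [:: _, _ & u]; set t := [:: _, _ & u] => hs.
have us := code_uniq hs.
have ab : a != b.
  by move: us => /= /andP[]; rewrite inE xpair_eqE eqxx andbT negb_or => /andP[].
have A c : c \in [:: a; b] -> c \in arrows s.
  move=> hc; rewrite mem_arrows; apply: (@code_mem _ _ k) => //.
  by move: hc; rewrite /s !inE !xpair_eqE eqxx !andbT => /orP[] ->; rewrite ?orbT.
have H e : height t e = height s e + swap_gain false (a, k) (b, k) e.
  exact: (@height_swap_if false [::]).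
have ub := arrows_uniq us.
have p : perm_eq (arrows t) (arrows s).
  by apply/perm_arrows; rewrite (perm_catCA [:: (b, k)] [:: (a, k)]).
rewrite /odd_writhe (perm_big _ p) -sumrB.
rewrite (big_rem a) ?(big_rem b (r := rem a _)) /=; first last.
- by rewrite A ?mem_head.
- by rewrite mem_rem_uniq // inE eq_sym ab A // !inE eqxx orbT.
rewrite big_seq big1 ?addr0; last first.
  move=> c; rewrite mem_rem_uniq ?rem_uniq // inE mem_rem_uniq // inE.
  case/and3P=> cb ca _.
  rewrite /crossing_term /chord_index !H /swap_gain !xpair_eqE.
  by rewrite (negPf ca) (negPf cb) !mulr0n subrr mulr0 !addr0 subrr.
apply: (le_trans (coef_normD _ _)); apply: (@lerD _ _ 1 _ 1);
  apply: coef_norm_termB; rewrite /chord_index !H /swap_gain !xpair_eqE !eqxx.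
- rewrite (negPf ab) /endpoint_sign /=.
  by case: (k); case: (sign_cases b) => ->; rewrite /= expr0; lia.
- rewrite eq_sym (negPf ab) /endpoint_sign /=.
  by case: (k); case: (sign_cases a) => ->; rewrite /= expr0; lia.
Qed.

Lemma unknotted_in_norm n K (D : gauss_diagram) :
  unknotted_in n K -> knot_of D = K -> coef_norm (odd_writhe D) <= 2 * n%:Z.
Proof.
move=> h; elim: h D => {n K} [|n D E m _ IHn] D' /writhe_knot ->.
  by rewrite /odd_writhe big_nil coef_norm0.
rewrite -(subrK (odd_writhe E) (odd_writhe D)).
apply: (le_trans (coef_normD _ _)).
have -> : 2 * n.+1%:Z = 2 + 2 * n%:Z by lia.
apply: lerD; last exact: IHn.
have := codeP D; move: m; move: (code D) (code E) => s t.
by case=> {s t} a b u hs; apply: forbidden_move_norm.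
Qed.

Theorem corollary14 (K : virtual_knot) (D : gauss_diagram)
    (hD : knot_of D = K) :
  let W := odd_writhe_polynomial D in
  1 / 2 * (\sum_(i <- msupp W) `|W@_i|)%:~R <= (forbidden_number K)%:R :> rat.
Proof.
rewrite odd_writhe_polynomialE /= -/(coef_norm _) /forbidden_number.
case: ex_minnP => n /asboolP h _.
rewrite div1r ler_pdivrMl // -[n%:R]/(n%:Z%:~R) -[2]/(2%:~R) -intrM ler_int.
exact: unknotted_in_norm h hD.
Qed.
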